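(* Let $G$ be a fixed edge-ordered graph with minimal edge $e_0=ab$ such that $G-e_0$ is bipartite and $N_G[a]=N_G[b]$. Then $sat_m(n,G)=O(n\log n)$.
   Context: An edge-ordered graph is a finite simple graph together with a linear order on its edge set (usually given by an injective labeling $l:E\to\mathbb{N}$ or $l:E\to\mathbb{R}$). An edge-ordered graph $H$ contains $G$ (has a copy of $G$) if $G$ is isomorphic, by an isomorphism respecting the edge-order, to a subgraph of $H$ with the induced order; otherwise $H$ is $G$-free. The minimal edge is the edge with the smallest label. $N_G[a]$ denotes the closed neighborhood of $a$ in $G$, and $G-e_0$ is $G$ with the edge $e_0$ deleted (vertices kept). $sat_m(n,G)$ is the minimum number of edges in a $G$-free edge-ordered graph $H$ on $n$ vertices such that adding to $H$ any missing edge, inserted at the beginning of the linear order (i.e. with a label smaller than all labels of $H$), creates a copy of $G$. Asymptotic notation is for $n\to\infty$ with $G$ fixed. *)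

(* Defs.v *)
From mathcomp Require Import all_boot all_order all_algebra.
From mathcomp Require Import all_classical all_reals all_analysis.

Set Implicit Arguments.
Unset Strict Implicit.
Unset Printing Implicit Defensive.

Import Order.TTheory GRing.Theory Num.Theory.
Import numFieldNormedType.Exports.

(* Only the values of [label] on [edges] matter: all notions below depend on
   the labelling solely through the linear order it induces on the edges. *)
Record eograph (V : finType) := EOGraph {
  edges : {set {set V}};
  label : {set V} -> nat;
  edges_card2 : forall e, e \in edges -> #|e| = 2;
  label_inj : {in edges &, injective label}
}.

Section EdgeOrdered.
Variable V : finType.
Implicit Types (G : eograph V) (e : {set V}) (a b x y : V).

Definition min_edge G e : Prop :=
  e \in edges G /\ (forall f, f \in edges G -> label G e <= label G f).

Definition closed_nbhd G a : {set V} :=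
  [set x | (x == a) || ([set a; x] \in edges G)].

Lemma del_edge_card2 G e f : f \in edges G :\ e -> #|f| = 2.
Proof. by move=> /setD1P[_]; exact: edges_card2. Qed.

Lemma del_edge_inj G e : {in edges G :\ e &, injective (label G)}.
Proof. by move=> f g /setD1P[_ fG] /setD1P[_ gG]; exact: label_inj. Qed.

Definition del_edge G e : eograph V :=
  EOGraph (@del_edge_card2 G e) (@del_edge_inj G e).

Definition bipartite G : Prop :=
  exists c : V -> bool, forall x y, [set x; y] \in edges G -> c x != c y.

(* The old labels are shifted up so that 0 is available for the new edge. *)
Definition first_label G e (f : {set V}) : nat :=
  if f == e then 0 else (label G f).+1.

Lemma add_first_card2 G e (he : #|e| = 2) f : f \in e |: edges G -> #|f| = 2.
Proof. by move=> /setU1P[->//|]; exact: edges_card2. Qed.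

Lemma add_first_inj G e : {in e |: edges G &, injective (first_label G e)}.
Proof.
move=> f g; rewrite /first_label !inE.
case: eqVneq => [->|_] /=; case: eqVneq => [->|_] //= fG gG [].
exact: label_inj.
Qed.

Definition add_first G e (he : #|e| = 2) : eograph V :=
  EOGraph (@add_first_card2 G e he) (@add_first_inj G e).

End EdgeOrdered.

Definition contains (W V : finType) (H : eograph W) (G : eograph V) : Prop :=
  exists phi : V -> W,
    [/\ injective phi,
        (forall e, e \in edges G -> phi @: e \in edges H) &
        (forall e f, e \in edges G -> f \in edges G ->
           (label H (phi @: e) < label H (phi @: f)) =
           (label G e < label G f))].

Definition saturated (W V : finType) (H : eograph W) (G : eograph V) : Prop :=
  ~ contains H G /\
  (forall (e : {set W}) (he : #|e| = 2), e \notin edges H -> contains (add_first H he) G).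

Definition sat_size (V : finType) (G : eograph V) (n k : nat) : Prop :=
  exists H : eograph 'I_n, saturated H G /\ #|edges H| = k.

Definition is_sat_m (V : finType) (G : eograph V) (n k : nat) : Prop :=
  sat_size G n k /\ (forall j, sat_size G n j -> k <= j).

(* The default 0 is never used when G has an edge, see [sat_mP]. *)
Definition sat_m (n : nat) (V : finType) (G : eograph V) : nat :=
  xget 0 [set k | is_sat_m G n k]%classic.

Section SatM.
Variables (V : finType) (G : eograph V) (n : nat).

Lemma free_saturated (H : eograph 'I_n) :
  ~ contains H G -> exists H' : eograph 'I_n, saturated H' G.
Proof.
have [m] := ubnP (#|{set 'I_n}| - #|edges H|).
elim: m H => // m IH H ltm freeH.
have [satH|nsatH] := pselect (saturated H G); first by exists H.
have [e [he [eH free']]] : exists (e : {set 'I_n}) (he : #|e| = 2),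
    e \notin edges H /\ ~ contains (add_first H he) G.
  apply: contrapT => nex; apply: nsatH; split=> // e he eH.
  by apply: contrapT => nc; apply: nex; exists e, he.
apply: (IH (add_first H he)) => //=.
have lt1 : #|edges H| < #|{set 'I_n}|.
  have := max_card (mem (e |: edges H)); by rewrite cardsU1 eH.
rewrite cardsU1 eH add1n subnS; move: ltm; rewrite ltnS.
by apply: leq_trans; rewrite prednK // subn_gt0.
Qed.

Lemma sat_mP : edges G != finset.set0 -> is_sat_m G n (sat_m n G).
Proof.
move=> /set0Pn[e0 e0G].
have c0 (e : {set 'I_n}) : e \in finset.set0 -> #|e| = 2 by rewrite inE.
have i0 : {in (finset.set0 : {set {set 'I_n}}) &, injective (fun _ : {set 'I_n} => 0)}.
  by move=> e f; rewrite inE.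
have [|H satH] := @free_saturated (EOGraph c0 i0).
  by case=> phi [_ /(_ _ e0G)]; rewrite inE.
have exk : exists k, `[< sat_size G n k >].
  by exists #|edges H|; apply/asboolP; exists H.
apply: (@xgetPex _ 0 [set k | is_sat_m G n k]%classic).
case: (ex_minnP exk) => k /asboolP kP kmin.
by exists k; split=> // j /asboolP; exact: kmin.
Qed.

End SatM.

(* Main.v *)
Require Import Defs.
From mathcomp Require Import all_boot all_order all_algebra.
From mathcomp Require Import all_classical all_reals all_analysis.
Import Order.TTheory GRing.Theory Num.Theory.
Import numFieldNormedType.Exports.

Set Implicit Arguments.
Unset Strict Implicit.
Unset Printing Implicit Defensive.

(** Any [G]-free [H0] extends greedily, by inserting first edges, to a saturated
    graph, and the pairs that already create a copy of [G] over [H0] are never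
    used; so [sat_m] is at most the number of remaining pairs.

    If [a] and [b] have a common neighbour, take [t ~ log n] disjoint copies
    ("gadgets") of [G' = G - ab].  Give each of the other vertices distinct [t]-bit
    codes and attach it to the [i]-th gadget as [a] or as [b] according to its
    [i]-th bit, ordering all edges primarily by the edge of [G'] they represent.
    Two such vertices differ in some bit [i], so joining them by a new first edge
    yields [G] through gadget [i]: only the [O(n log n)] pairs meeting a gadget
    remain.  Since [a] and [b] have the same colour in [G'], the resulting graph is
    bipartite, whereas [G] contains a triangle.  If [ab] is an isolated edge of
    [G], a single gadget is enough, and it has fewer edges than [G]. *)

(** * Greedy saturation inside a prescribed set of pairs *)

Section Saturation.
Variables W V : finType.
Implicit Types (G : eograph V) (H : eograph W) (S : {set {set W}}).

(** Labels are compared only through their order, since each call of [add_first] shifts the old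
    ones. *)
Definition extends H H' : Prop :=
  edges H \subset edges H' /\
  {in edges H &, forall e f, (label H' e < label H' f) = (label H e < label H f)}.

Lemma extends_add_first H H' (e : {set W}) (he : #|e| = 2) :
  e \notin edges H' -> extends H H' -> extends H (add_first H' he).
Proof.
move=> eH' [sHH' lHH']; split=> /=.
  by apply: fintype.subset_trans sHH' _; exact: finset.subsetUr.
move=> f1 f2 f1H f2H.
have ne f : f \in edges H -> (f == e) = false.
  by move=> /(fintype.subsetP sHH') fH'; apply: contraNF eH' => /eqP<-.
by rewrite /first_label !ne// ltnS lHH'.
Qed.

(** The same embedding works: [e] comes first over both graphs, and the other edges used lie in [H],
    where the orders agree. *)
Lemma contains_add_first_extends G H H' (e : {set W}) (he : #|e| = 2) :
  extends H H' -> contains (add_first H he) G -> contains (add_first H' he) G.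
Proof.
move=> [sHH' lHH'] [phi [phiI phiE phiL]]; exists phi; split=> //=.
  by move=> f /phiE /=; apply/fintype.subsetP; exact: finset.setUS.
move=> f1 f2 f1G f2G; rewrite -(phiL _ _ f1G f2G) /= /first_label.
have := phiE _ f1G; have := phiE _ f2G; rewrite /= !inE.
case: eqVneq => //= _ f2H; case: eqVneq => //= _ f1H.
by rewrite !ltnS lHH'.
Qed.

Lemma saturated_within G H0 S :
  ~ contains H0 G -> edges H0 \subset S ->
  (forall (e : {set W}) (he : #|e| = 2), e \notin S ->
     contains (add_first H0 he) G) ->
  exists2 H, saturated H G & edges H \subset S.
Proof.
move=> free0 sH0S goodS.
suff: forall m H, #|S| - #|edges H| < m -> ~ contains H G -> extends H0 H ->
    edges H \subset S -> exists2 H', saturated H' G & edges H' \subset S.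
  by move/(_ _ H0 (leqnn _)); apply=> //; split.
elim=> // m IH H ltm freeH extH sHS.
have [satH|nsatH] := pselect (saturated H G); first by exists H.
have [e [he [eH free']]] : exists (e : {set W}) (he : #|e| = 2),
    e \notin edges H /\ ~ contains (add_first H he) G.
  apply: contrapT => nex; apply: nsatH; split=> // e he eH.
  by apply: contrapT => nc; apply: nex; exists e, he.
have eS : e \in S.
  apply/negPn/negP => /(goodS _ he).
  by move=> /(contains_add_first_extends extH).
have sS : e |: edges H \subset S by rewrite finset.subUset finset.sub1set eS.
apply: (IH (add_first H he)) => //=; last exact: extends_add_first.
have := subset_leq_card sS; rewrite cardsU1 eH add1n => lt1.
rewrite subnS; move: ltm; rewrite ltnS.
by apply: leq_trans; rewrite prednK // subn_gt0.
Qed.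

End Saturation.

Lemma sat_m_le_card (V : finType) (G : eograph V) (n : nat)
    (H0 : eograph 'I_n) (S : {set {set 'I_n}}) :
  edges G != finset.set0 -> ~ contains H0 G -> edges H0 \subset S ->
  (forall (e : {set 'I_n}) (he : #|e| = 2), e \notin S ->
     contains (add_first H0 he) G) ->
  sat_m n G <= #|S|.
Proof.
move=> G0 free0 sH0S /(saturated_within free0 sH0S)[H satH sHS].
apply: leq_trans (subset_leq_card sHS).
by apply: (sat_mP n G0).2; exists H.
Qed.

Lemma sat_m_le_sqr (V : finType) (G : eograph V) (n : nat) :
  edges G != finset.set0 -> sat_m n G <= n * n.
Proof.
move=> /[dup] G0 /set0Pn[e0 e0G].
have c0 (e : {set 'I_n}) : e \in finset.set0 -> #|e| = 2 by rewrite inE.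
have i0 : {in (finset.set0 : {set {set 'I_n}}) &, injective (fun _ => 0)}.
  by move=> e f; rewrite inE.
pose pairs := [set [set p.1; p.2] | p : 'I_n * 'I_n].
apply: leq_trans (@sat_m_le_card _ G n (EOGraph c0 i0) pairs G0 _ _ _) _.
- by case=> phi [_ /(_ _ e0G)]; rewrite inE.
- exact: finset.sub0set.
- move=> e he /negP[]; have /eqP/cards2P[x [y [_ ->]]] := he.
  by apply/imsetP; exists (x, y).
- by apply: leq_trans (leq_imset_card _ _) _; rewrite card_prod card_ord.
Qed.

Lemma imset_some_inj (V : finType) :
  injective (fun A : {set V} => [set Some x | x in A]).
Proof. by apply: imset_inj => x y []. Qed.

(** * The gadget graph and its copies of [G] *)

Section Gadgets.
Variables (V W : finType) (G : eograph V) (a b : V) (t : nat).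
Variables (g : 'I_t * V -> W) (code : W -> 'I_t -> bool).
Hypothesis g_inj : injective g.
Hypothesis hmin : min_edge G [set a; b].

Let G' := del_edge G [set a; b].

(* Gadget [i] is a copy of [G - ab] on the vertices [g (i, _)]; a vertex outside
   all gadgets joins gadget [i] as another copy of [a] or [b]. *)
Definition role (i : 'I_t) (w : W) : option V :=
  if [pick p | g p == w] is Some p then if p.1 == i then Some p.2 else None
  else Some (if code w i then b else a).

Lemma role_gadget i p : role i (g p) = if p.1 == i then Some p.2 else None.
Proof.
rewrite /role; case: pickP => [q /eqP/g_inj->//|/(_ p)].
by rewrite eqxx.
Qed.

Lemma role_outside i w :
  w \notin codom g -> role i w = Some (if code w i then b else a).
Proof.
move=> wg; rewrite /role; case: pickP => // p /eqP pw.
by rewrite -pw codom_f in wg.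
Qed.

(** Comparing images in [option V] excludes any [e] with an endpoint in a gadget other than [i],
    since that endpoint has role [None]. *)
Definition plays (e : {set W}) (f : {set V}) : bool :=
  [exists i, role i @: e == Some @: f].

(** The cardinality test matters because [role i] is not injective: larger sets can have the same
    image. *)
Definition gadget_edges : {set {set W}} :=
  [set e : {set W} | (#|e| == 2) && [exists f in edges G', plays e f]].

(** By [plays_uniq] at most one [f] qualifies, so the maximum merely reads off its label. *)
Definition level (e : {set W}) : nat :=
  \max_(f in edges G' | plays e f) label G f.

(** Lexicographic order: level first, ties broken by the rank of [e], which is below
    [#|{set W}|]. *)
Definition gadget_label (e : {set W}) : nat :=
  level e * #|{set W}| + enum_rank e.

Lemma gadget_card2 e : e \in gadget_edges -> #|e| = 2.
Proof. by rewrite inE => /andP[/eqP]. Qed.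

Lemma gadget_label_inj : {in gadget_edges &, injective gadget_label}.
Proof.
move=> e f _ _ /(congr1 (modn^~ #|{set W}|)).
by rewrite !modnMDl !modn_small// => /val_inj/enum_rank_inj.
Qed.

Lemma gadget_label_lt e f : level e < level f -> gadget_label e < gadget_label f.
Proof.
move=> lt_ef; rewrite /gadget_label.
apply: (@leq_trans ((level e).+1 * #|{set W}|)).
  by rewrite mulSnr ltn_add2l ltn_ord.
by rewrite (leq_trans _ (leq_addr _ _))// leq_mul2r lt_ef orbT.
Qed.

Definition gadget_graph : eograph W := EOGraph gadget_card2 gadget_label_inj.

(** Vertices outside the gadgets only play [a] or [b], so an edge between two of them could only
    play the deleted edge [ab]. *)
Lemma edge_meets_gadget i (e : {set W}) f :
    f \in edges G' -> role i @: e = Some @: f ->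
  exists2 x, x \in f & g (i, x) \in e.
Proof.
move=> fG' ef.
have [[w we wg]|out] := pselect (exists2 w, w \in e & w \in codom g).
  have /codomP[[j x] wE] := wg.
  have : role i w \in Some @: f by rewrite -ef imset_f.
  rewrite wE role_gadget /= => /imsetP[y yf]; case: eqP => // ij [xy].
  by exists y => //; rewrite -xy -ij -wE.
have sub : f \subset [set a; b].
  apply/fintype.subsetP => x xf.
  have : Some x \in role i @: e by rewrite ef imset_f.
  case/imsetP => w we; rewrite role_outside; last first.
    by apply/negP => wg; apply: out; exists w.
  by case=> ->; rewrite !inE; case: ifP; rewrite eqxx ?orbT.
have /setD1P[/eqP] := fG'; case=> //; apply/eqP.
rewrite eqEcard sub (edges_card2 fG').
by rewrite (edges_card2 hmin.1).
Qed.

(** A gadget vertex of [e] determines the gadget index, and the index determines the edge played. *)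
Lemma plays_uniq e f f' :
  f \in edges G' -> f' \in edges G' -> plays e f -> plays e f' -> f = f'.
Proof.
move=> fG f'G /existsP[i /eqP ef] /existsP[j /eqP ef'].
have [x xf xe] := edge_meets_gadget fG ef.
have : role j (g (i, x)) \in Some @: f' by rewrite -ef' imset_f.
rewrite role_gadget /=; case: eqP => [ij _|_ /imsetP[]//].
by apply: imset_some_inj; rewrite -ef -ef' ij.
Qed.

Lemma level_plays e f : f \in edges G' -> plays e f -> level e = label G f.
Proof.
move=> fG ef; rewrite /level (big_pred1 f)// => f'.
apply/andP/eqP => [[f'G ef']|->//].
exact: plays_uniq ef' ef.
Qed.

(** The new first edge serves as the minimal edge [ab]; every other edge of [G] is sent to an edge
    whose level is its own label, so the order is kept. *)
Lemma gadget_contains (phi : V -> W) (i : 'I_t)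
    (he : #|[set phi a; phi b]| = 2) :
  injective phi ->
  (forall f x, f \in edges G' -> x \in f -> role i (phi x) = Some x) ->
  contains (add_first gadget_graph he) G.
Proof.
move=> phiI phiR.
have e0E : phi @: [set a; b] = [set phi a; phi b] by rewrite imsetU !imset_set1.
have neE f : f \in edges G' -> (phi @: f == [set phi a; phi b]) = false.
  move=> /setD1P[fab _]; rewrite -e0E; apply: contra_neqF fab.
  by move=> /eqP/(imset_inj phiI).
have playsE f : f \in edges G' -> plays (phi @: f) f.
  move=> fG; apply/existsP; exists i; apply/eqP.
  rewrite -imset_comp; apply: eq_in_imset => x xf /=; exact: phiR xf.
have edgeP f : f \in edges G -> f = [set a; b] \/ f \in edges G'.
  by case: (eqVneq f [set a; b]) => [|ne fG]; [left|right; rewrite !inE ne].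
exists phi; split=> //= [f /edgeP[->|fG]|f1 f2 f1G f2G].
- by rewrite e0E !inE eqxx.
- rewrite !inE; apply/orP; right; rewrite card_imset// (edges_card2 fG) eqxx.
  by apply/existsP; exists f; apply/andP; split=> //; exact: playsE.
rewrite /first_label.
have [f1E|f1G'] := edgeP _ f1G; have [f2E|f2G'] := edgeP _ f2G.
- by rewrite f1E f2E !ltnn.
- rewrite f1E e0E eqxx neE//=; apply/esym.
  rewrite ltn_neqAle (hmin.2 _ f2G) andbT.
  apply: contraTneq f2G' => /(label_inj hmin.1 f2G) <-.
  by rewrite !inE eqxx.
- by rewrite f2E e0E eqxx neE//= ltn0 ltnNge (hmin.2 _ f1G).
rewrite !neE// ltnS.
have l1 := level_plays f1G' (playsE _ f1G').
have l2 := level_plays f2G' (playsE _ f2G').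
case: (ltngtP (label G f1) (label G f2)) => [lt|lt|eq].
- by apply: gadget_label_lt; rewrite l1 l2.
- by apply/negbTE; rewrite -leqNgt ltnW//; apply: gadget_label_lt; rewrite l1 l2.
- by rewrite (label_inj f1G f2G eq) ltnn.
Qed.

Definition gadget_pairs : {set {set W}} :=
  [set [set g p.1; p.2] | p : ('I_t * V) * W].

Lemma card_gadget_pairs : #|gadget_pairs| <= t * #|V| * #|W|.
Proof.
by apply: leq_trans (leq_imset_card _ _) _; rewrite !card_prod card_ord.
Qed.

Lemma gadget_pairsP u v :
  [set u; v] \notin gadget_pairs -> u \notin codom g /\ v \notin codom g.
Proof.
move=> uv; split; apply: contra uv => /codomP[p ->]; apply/imsetP.
  by exists (p, v).
by exists (p, u); rewrite // finset.setUC.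
Qed.

Lemma gadget_edges_sub : edges gadget_graph \subset gadget_pairs.
Proof.
apply/fintype.subsetP => e /=; rewrite inE => /andP[c2 /existsP[f /andP[fG]]].
case/existsP => i /eqP /(edge_meets_gadget fG)[x _ xe].
have /cards2P[u [v [_ eE]]] := c2; move: xe; rewrite eE !inE.
case/orP => /eqP xE; apply/imsetP; first by exists ((i, x), v); rewrite // xE.
by exists ((i, x), u); rewrite // xE finset.setUC.
Qed.

(** The copy uses [u] for [a], [v] for [b] and gadget [i] for the rest. Bits are constrained only if
    [a] or [b] has an edge in [G'], so that the isolated case is covered too. *)
Lemma gadget_contains_outside (i : 'I_t) (u v : W) (he : #|[set u; v]| = 2) :
  u \notin codom g -> v \notin codom g ->
  (forall f, f \in edges G' -> a \in f -> code u i = false) ->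
  (forall f, f \in edges G' -> b \in f -> code v i = true) ->
  contains (add_first gadget_graph he) G.
Proof.
move=> ug vg ua vb.
have neq_ab : b != a.
  by have := edges_card2 hmin.1; rewrite cards2 eq_sym; case: eqP.
have neq_uv : u != v by move: (he); rewrite cards2; case: eqP.
pose phi x := if x == a then u else if x == b then v else g (i, x).
have ne_g w x : w \notin codom g -> w <> g (i, x).
  by move=> wg wE; rewrite wE codom_f in wg.
have phia : phi a = u by rewrite /phi eqxx.
have phib : phi b = v by rewrite /phi (negbTE neq_ab) eqxx.
move: he; rewrite -phia -phib => he.
apply: (@gadget_contains phi i).
  move=> x y; rewrite /phi.
  case: (eqVneq x a) => [->|xa]; case: (eqVneq y a) => [->|ya] //.
  - case: (eqVneq y b) => [_ uv|_ /(ne_g _ _ ug)//].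
    by rewrite uv eqxx in neq_uv.
  - case: (eqVneq x b) => [_ uv|_ /esym/(ne_g _ _ ug)//].
    by rewrite uv eqxx in neq_uv.
  - case: (eqVneq x b) => [->|xb]; case: (eqVneq y b) => [->|yb] //.
    + by move=> /(ne_g _ _ vg).
    + by move=> /esym/(ne_g _ _ vg).
    + by move=> /g_inj[].
move=> f x fG xf; rewrite /phi.
case: (eqVneq x a) xf => [-> af|xa xf].
  by rewrite role_outside// (ua f).
case: (eqVneq x b) xf => [-> bf|xb xf].
  by rewrite role_outside// (vb f).
by rewrite role_gadget eqxx.
Qed.

(** The common neighbour [x] forces [c a = c b], so the colour of an outside vertex does not depend
    on its role. Colouring by roles is then proper, which the triangle [a], [b], [x] forbids. *)
Lemma gadget_free_triangle (x : V) :
  bipartite G' -> [set a; x] \in edges G' -> [set b; x] \in edges G' ->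
  ~ contains gadget_graph G.
Proof.
case=> c cP ax bx [phi [_ phiE _]].
have cab : c a = c b.
  by have := cP _ _ ax; have := cP _ _ bx; case: (c a) (c b) (c x) => [] [] [].
pose col w := if [pick p | g p == w] is Some p then c p.2 else c a.
have colE i w y : role i w = Some y -> col w = c y.
  rewrite /role /col; case: pickP => [p _|_ [<-]]; last by case: ifP.
  by case: ifP => // _ [<-].
have colP u v : [set u; v] \in gadget_edges -> col u != col v.
  rewrite inE => /andP[c2 /existsP[f /andP[fG /existsP[i /eqP ef]]]].
  have : #|Some @: f| = 2 by rewrite card_imset ?(edges_card2 fG)//; exact: Some_inj.
  have : role i u \in Some @: f by rewrite -ef imset_f// !inE eqxx.
  have : role i v \in Some @: f by rewrite -ef imset_f// !inE eqxx orbT.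
  case/imsetP => y _ vy /imsetP[z _ uz].
  rewrite -ef imsetU !imset_set1 vy uz cards2 (colE _ _ _ vy) (colE _ _ _ uz).
  move=> _; apply: cP.
  have -> // : [set z; y] = f.
  apply: imset_some_inj.
  by rewrite -ef imsetU !imset_set1 imsetU !imset_set1 vy uz.
have sub y z : [set y; z] \in edges G -> col (phi y) != col (phi z).
  by move=> /phiE; rewrite imsetU !imset_set1 => /colP.
have := sub _ _ hmin.1; have /setD1P[_ /sub] := ax; have /setD1P[_ /sub] := bx.
by case: (col _) (col _) (col _) => [] [] [].
Qed.

(** Outside vertices receive no edges here, so the graph has at most as many edges as [G'], one
    fewer than [G]. *)
Lemma gadget_free_isolated :
  t = 1 -> (forall f, f \in edges G' -> a \notin f /\ b \notin f) ->
  ~ contains gadget_graph G.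
Proof.
move=> t1 iso [phi [phiI phiE _]].
have le1 : #|edges G| <= #|gadget_edges|.
  rewrite -(card_imset _ (imset_inj phiI)); apply: subset_leq_card.
  by apply/fintype.subsetP => _ /imsetP[f fG ->]; exact: phiE.
have sub : gadget_edges \subset
    [set (fun x => g (p.1, x)) @: p.2 |
      p : 'I_t * {set V} in finset.setX [set: 'I_t] (edges G')].
  apply/fintype.subsetP => e.
  rewrite inE => /andP[/eqP c2 /existsP[f /andP[fG /existsP[i /eqP ef]]]].
  apply/imsetP; exists (i, f); first by rewrite inE /= finset.in_setT fG.
  have gI : injective (fun x => g (i, x)) by move=> x y /g_inj[].
  apply/eqP; rewrite eqEcard c2 card_imset//= (edges_card2 fG) andbT.
  apply/fintype.subsetP => w we.
  have : role i w \in Some @: f by rewrite -ef imset_f.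
  have [/codomP[[j x] ->]|wg] := boolP (w \in codom g).
    rewrite role_gadget /=; case: eqP => [->|_ /imsetP[]//].
    by case/imsetP => y yf [->]; apply/imsetP; exists y.
  have [af bf] := iso _ fG.
  rewrite role_outside// => /imsetP[y yf [yE]]; move: yf.
  by rewrite -yE; case: ifP => _; rewrite ?(negbTE af) ?(negbTE bf).
have := leq_trans le1 (leq_trans (subset_leq_card sub) (leq_imset_card _ _)).
rewrite cardsX cardsT card_ord t1 mul1n.
by rewrite (cardsD1 [set a; b] (edges G)) hmin.1 add1n ltnn.
Qed.

End Gadgets.

(** * The bound for a given number of code bits *)

Lemma sat_m_gadget_bound (V : finType) (G : eograph V) (a b : V) (n t : nat) :
  min_edge G [set a; b] -> bipartite (del_edge G [set a; b]) ->
  closed_nbhd G a = closed_nbhd G b -> 0 < t -> n <= 2 ^ t ->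
  sat_m n G <= t * #|V| * n.
Proof.
move=> hmin hbip hN t0 nt.
have G0 : edges G != finset.set0 by apply/set0Pn; exists [set a; b]; exact: hmin.1.
(* When the gadgets may not fit into [n] vertices, the trivial bound [n * n] suffices. *)
have [nle|/ltnW le_n] := leqP n (t * #|V|).
  by apply: leq_trans (sat_m_le_sqr _ G0) _; rewrite leq_mul2r nle orbT.
have neq_ab : a != b by have := edges_card2 hmin.1; rewrite cards2; case: eqP.
have embed s : s <= t -> exists g : 'I_s * V -> 'I_n, injective g.
  move=> st.
  have le_sn : #|{: 'I_s * V}| <= n.
    by rewrite card_prod card_ord (leq_trans _ le_n)// leq_mul2r st orbT.
  exists (fun p => widen_ord le_sn (enum_rank p)).
  by move=> p q /(congr1 val) /= /val_inj/enum_rank_inj.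
have pairP (e : {set 'I_n}) : #|e| = 2 -> exists u v, u != v /\ e = [set u; v].
  by move/eqP/cards2P => [u [v [uv ->]]]; exists u, v.
(* By [hN], a neighbour of [a] in [G - ab] is also one of [b]; without any, [ab] is an isolated
   edge. *)
have [[x xa]|iso] := pselect (exists x, [set a; x] \in edges (del_edge G [set a; b])).
  have [xb xG] : x != b /\ [set a; x] \in edges G.
    move: xa => /setD1P[ne xG]; split=> //.
    by apply: contra_neq ne => ->.
  have bxG : [set b; x] \in edges G.
    have : x \in closed_nbhd G a by rewrite inE xG orbT.
    by rewrite hN inE (negbTE xb).
  have xa' : x != a by have := edges_card2 xG; rewrite cards2 eq_sym; case: eqP.
  have bx : [set b; x] \in edges (del_edge G [set a; b]).
    rewrite !inE bxG andbT; apply/eqP => /setP/(_ a).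
    by rewrite !inE eqxx (negbTE neq_ab) eq_sym (negbTE xa').
  have [g gI] := embed t (leqnn _).
  have le_c : n <= #|{ffun 'I_t -> bool}| by rewrite card_ffun card_bool card_ord.
  pose code (u : 'I_n) : {ffun 'I_t -> bool} := enum_val (widen_ord le_c u).
  have codeI : injective code.
    by move=> u v /enum_val_inj/(congr1 val) /= /val_inj.
  apply: leq_trans (_ : #|gadget_pairs g| <= _); last first.
    by have := card_gadget_pairs g; rewrite card_ord.
  apply: (@sat_m_le_card _ _ _ (gadget_graph G a b g code)) => //.
  - exact: gadget_free_triangle xa bx.
  - exact: gadget_edges_sub.
  move=> e he eS; have [u [v [uv eE]]] := pairP _ he; subst e.
  have [ug vg] := gadget_pairsP eS.
  have [i ci] : exists i, code u i != code v i.
    apply: contrapT => nex; move/eqP: uv; apply; apply: codeI; apply/ffunP => i.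
    by apply/eqP/negPn/negP => ci; apply: nex; exists i.
  (* The endpoint with bit [false] has to play [a]; in the other case the two ends are swapped. *)
  case cu : (code u i); last first.
    apply: (@gadget_contains_outside _ _ _ _ _ _ _ _ gI hmin i) => // f _ _.
    by move: ci; rewrite cu; case: (code v i).
  move: he eS; rewrite finset.setUC => he eS.
  apply: (@gadget_contains_outside _ _ _ _ _ _ _ _ gI hmin i) => // f _ _.
  by move: ci; rewrite cu; case: (code v i).
have isoP f : f \in edges (del_edge G [set a; b]) -> a \notin f /\ b \notin f.
  move=> /[dup] fG' /setD1P[fab fG].
  have /eqP/cards2P[y [z [yz fE]]] := edges_card2 fG.
  have ia x : [set a; x] \in edges G -> x = b.
    move=> xG; apply: contrapT => xb; apply: iso; exists x.
    rewrite !inE xG andbT; apply/eqP => /setP/(_ x).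
    rewrite !inE eqxx orbT (negbTE (introN eqP xb)) orbF => /esym/eqP xa.
    by have := edges_card2 xG; rewrite xa finset.setUid cards1.
  have ib x : [set b; x] \in edges G -> x = a.
    move=> xG; have : x \in closed_nbhd G b by rewrite inE xG orbT.
    rewrite -hN inE => /orP[/eqP//|/ia xb].
    by have := edges_card2 xG; rewrite xb finset.setUid cards1.
  have nab x : f = [set a; x] -> False.
    move=> E; move: fG fab; rewrite E => /ia ->.
    by rewrite eqxx.
  have nbb x : f = [set b; x] -> False.
    move=> E; move: fG fab; rewrite E => /ib ->.
    by rewrite finset.setUC eqxx.
  rewrite fE !inE; split; apply/negP => /orP[]/eqP E; subst.
  - exact: nab erefl.
  - by apply: (nab y); rewrite finset.setUC.
  - exact: nbb erefl.
  - by apply: (nbb y); rewrite finset.setUC.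
have [g gI] := embed 1 t0.
apply: leq_trans (_ : #|gadget_pairs g| <= _); last first.
  have := card_gadget_pairs g; rewrite card_ord => /leq_trans; apply.
  by rewrite !leq_mul2r t0 !orbT.
apply: (@sat_m_le_card _ _ _ (gadget_graph G a b g (fun _ _ => false))) => //.
- exact: gadget_free_isolated.
- exact: gadget_edges_sub.
move=> e he eS; have [u [v [uv eE]]] := pairP _ he; subst e.
have [ug vg] := gadget_pairsP eS.
(* The constant code lets [u] play [a]; the condition on [v] is vacuous, as no edge of [G - ab]
   contains [b]. *)
apply: (@gadget_contains_outside _ _ _ _ _ _ _ _ gI hmin ord0) => // f fG.
by rewrite (negbTE (isoP _ fG).2).
Qed.

(** * Asymptotics *)

Local Open Scope ring_scope.
Local Open Scope classical_set_scope.

(** With [k = trunc_log 2 n], [1 < n] gives [1 <= k], so [k + 1 <= 2 * k], while [2 ^ k <= n] gives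
    [k * ln 2 <= ln n]. *)
Lemma trunc_log_le_ln (R : realType) (n : nat) :
  (1 < n)%N -> (trunc_log 2 n).+1%:R <= 2 / ln 2 * ln n%:R :> R.
Proof.
move=> n1.
have ln2 : 0 < ln 2 :> R by rewrite ln_gt0// ltr1n.
have k0 : (0 < trunc_log 2 n)%N by rewrite trunc_log_gt0.
have le1 : ln (2 ^+ trunc_log 2 n) <= ln n%:R :> R.
  rewrite ler_ln ?posrE ?exprn_gt0 ?ltr0n ?(ltnW n1)// -natrX ler_nat.
  by rewrite trunc_logP// (ltnW n1).
rewrite lnXn// in le1.
rewrite mulrAC ler_pdivlMr//.
apply: le_trans (_ : 2 * (ln 2 *+ trunc_log 2 n) <= _); last by rewrite ler_pM2l.
rewrite -[ln 2 *+ _]mulr_natl mulrA ler_pM2r// -natrM ler_nat mul2n -addnn.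
by rewrite -addn1 leq_add2l.
Qed.

Theorem theorem8 (R : realType) (V : finType) (G : eograph V) (a b : V)
  (hmin : min_edge G [set a; b]%SET)
  (hbip : bipartite (del_edge G [set a; b]%SET))
  (hN : closed_nbhd G a = closed_nbhd G b) :
  (fun n : nat => (sat_m n G)%:R : R) =O_\oo
  (fun n : nat => n%:R * ln n%:R : R).
Proof.
have V0 : (0 < #|V|)%N by apply/card_gt0P; exists a.
apply/eqO_exP; exists (2 / ln 2 * #|V|%:R).
  by rewrite !mulr_gt0 ?invr_gt0 ?ln_gt0 ?ltr1n ?ltr0n.
near=> n.
have n1 : (1 < n)%N by near: n; exact: nbhs_infty_gt.
rewrite !ger0_norm ?mulr_ge0 ?ln_ge0 ?ler1n ?(ltnW n1)//.
(* This many bits give [n] distinct codes. *)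
have le_n : (n <= 2 ^ (trunc_log 2 n).+1)%N by rewrite ltnW// trunc_log_ltn.
have := sat_m_gadget_bound hmin hbip hN (ltn0Sn _) le_n.
rewrite -(ler_nat R) => /le_trans; apply.
rewrite !natrM -mulrA [n%:R * ln _]mulrC mulrACA.
by rewrite ler_wpM2r ?mulr_ge0// trunc_log_le_ln.
Unshelve. all: by end_near.
Qed.
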